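(* For all integers $\ell\ge1$ (and all $n\ge0$ in the last two congruences): \[ \sum_{n=0}^{\infty}\overline{p}_{2\ell}(2n)q^n\equiv \frac{1}{\varphi(-q^2)\varphi(-q^\ell)}\pmod{4}, \] \[ \sum_{n=0}^{\infty}\overline{p}_{3\ell}(3n)q^n\equiv\frac{\varphi(-q^3)^3}{\varphi(-q^\ell)}\pmod{8}, \] \[ \sum_{n=0}^{\infty}\overline{p}_{2\ell}(2n+1)q^n\equiv2\,\frac{\psi(q^4)}{\varphi(-q^\ell)}\pmod{8}, \] \[ \overline{p}_{3\ell}(3n+1)\equiv 0 \pmod{2}, \] \[ \overline{p}_{3\ell}(3n+2)\equiv0 \pmod{4}. \]
   Context: For $k\ge1$ let $f_k=\prod_{m\ge1}(1-q^{km})$. For an integer $\ell\ge1$, $\overline{p}_\ell(n)$ denotes the number of 2-color overpartitions of $n$ (the first occurrence of a part of each color may be overlined) in which one of the two colors appears only in parts that are multiples of $\ell$; its generating function is $\sum_{n\ge0}\overline{p}_\ell(n)q^n=\dfrac{f_2f_{2\ell}}{f_1^2f_\ell^2}$. Ramanujan's theta functions are $\varphi(q)=\sum_{n\in\mathbb Z}q^{n^2}=\dfrac{f_2^5}{f_1^2f_4^2}$ and $\psi(q)=\sum_{n\ge0}q^{n(n+1)/2}=\dfrac{f_2^2}{f_1}$; thus $\varphi(-q^\ell)=\sum_{n\in\mathbb Z}(-1)^nq^{\ell n^2}=f_\ell^2/f_{2\ell}$, where $-q^\ell$ means $-(q^\ell)$. Congruences between power series with integer coefficients are coefficientwise. 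*)

(* Defs.v *)
From HB Require Import structures.
From mathcomp Require Import all_boot all_order all_algebra.

Set Implicit Arguments.
Unset Strict Implicit.
Unset Printing Implicit Defensive.

Import GRing.Theory.
Local Open Scope ring_scope.

(* A formal power series over [R] is its coefficient sequence [nat -> R].     *)

Definition psmul (R : comUnitRingType) (f g : nat -> R) : nat -> R :=
  fun n => \sum_(i < n.+1) f i * g (n - i)%N.

Definition psone (R : comUnitRingType) : nat -> R := fun n => (n == 0%N)%:R.

Definition psexp (R : comUnitRingType) (f : nat -> R) (k : nat) : nat -> R :=
  iter k (psmul f) (@psone R).

Definition psscale (R : comUnitRingType) (c : R) (f : nat -> R) : nat -> R :=
  fun n => c * f n.

(* [pscomp c k f] is f(c q^k), for k >= 1; the sign is outside the power,     *)
(* so that [pscomp (-1) k f] is f(-(q^k)).                                    *)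
Definition pscomp (R : comUnitRingType) (c : R) (k : nat) (f : nat -> R) :
    nat -> R :=
  fun n => if (k %| n)%N then c ^+ (n %/ k) * f (n %/ k)%N else 0.

(* The first n coefficients of 1 / f, for f with invertible constant term.    *)
Fixpoint psinv_seq (R : comUnitRingType) (f : nat -> R) (n : nat) : seq R :=
  if n is m.+1 then
    let s := psinv_seq f m in
    rcons s ((f 0%N)^-1 * (psone R m - \sum_(i < m) s`_i * f (m - i)%N))
  else [::].

Definition psinv (R : comUnitRingType) (f : nat -> R) : nat -> R :=
  fun n => (psinv_seq f n.+1)`_n.

Definition psdiv (R : comUnitRingType) (f g : nat -> R) : nat -> R :=
  psmul f (psinv g).

Lemma size_psinv_seq (R : comUnitRingType) (f : nat -> R) (n : nat) :
  size (psinv_seq f n) = n.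
Proof. by elim: n => //= n IHn; rewrite size_rcons IHn. Qed.

Lemma nth_psinv_seq (R : comUnitRingType) (f : nat -> R) (n i : nat) :
  (i < n)%N -> (psinv_seq f n)`_i = psinv f i.
Proof.
elim: n => // n IHn; rewrite ltnS leq_eqVlt => /predU1P[-> //|lt_in].
by rewrite /= nth_rcons size_psinv_seq lt_in IHn.
Qed.

Lemma psmulVf (R : comUnitRingType) (f : nat -> R) (n : nat) :
  f 0%N \is a GRing.unit -> psmul (psinv f) f n = psone R n.
Proof.
move=> Uf; rewrite /psmul big_ord_recr /= subnn.
rewrite {2}/psinv /= nth_rcons size_psinv_seq ltnn eqxx.
rewrite mulrC mulVKr //.
rewrite (eq_bigr (fun i : 'I_n => (psinv_seq f n)`_i * f (n - i)%N)).
  by rewrite addrC subrK.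
by move=> i _; rewrite nth_psinv_seq.
Qed.

Definition pscong (m : nat) (f g : nat -> int) : Prop :=
  forall n : nat, (f n = g n %[mod m%:Z])%Z.

(* phi(q) is the sum of q^(j^2) over all integers j; the index i stands for   *)
(* j = i - n, and j^2 = n forces -n <= j <= n.                                *)
Definition phi : nat -> int :=
  fun n => \sum_(i < n.*2.+1 | (i%:Z - n%:Z) ^+ 2 == n%:Z) 1.

Definition psi : nat -> int :=
  fun n => \sum_(i < n.+1 | (i * i.+1 %/ 2 == n)%N) 1.

(* A 2-colour overpartition of n: for each part size i + 1 <= n and each      *)
(* colour c, the multiplicity [(F (i, c)).1] and a bit [(F (i, c)).2] telling *)
(* whether the first occurrence is overlined, which requires an occurrence.   *)
(* Parts of colour [true] must be multiples of l.                             *)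
Definition overpartition2 (l n : nat)
    (F : {ffun 'I_n * bool -> 'I_n.+1 * bool}) : bool :=
  [&& [forall x, (F x).2 ==> (0 < (F x).1)%N],
      [forall i, (0 < (F (i, true)).1)%N ==> (l %| i.+1)%N]
    & (\sum_(i < n) \sum_(c : bool) i.+1 * (F (i, c)).1 == n)%N].

Definition overp (l n : nat) : nat :=
  #|[set F : {ffun 'I_n * bool -> 'I_n.+1 * bool} | overpartition2 l F]|.

(* Main.v *)
(* With [a = 1 / phi(-q)], Gauss's product for [phi(-q)] turns the generating
   function of [overp l] into [a(q) a(q^l)]. When [l] is replaced by [d l], the
   second factor only has exponents divisible by [d], so the coefficients in a
   residue class modulo [d] are obtained by dissecting [a(q)] alone. Modulo 8,
   [a] is [1 - 2 b + 4 b^2] with [phi(-q) = 1 + 2 b], hence explicit in terms of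
   squares and doubles of squares, and its dissections are read off. Gauss's
   product is obtained from Shanks's finite version, a telescoping sum:
   [prod_(i <= n) (1 + x^i) (1 + 2 sum_(s <= n) (-1)^s x^(s^2))] agrees with
   [prod_(i <= n) (1 - x^i)] up to [O(x^(n+1))]. *)

Require Import Defs.
From mathcomp Require Import all_boot all_order all_algebra.
From mathcomp Require Import ring zify.

Set Implicit Arguments.
Unset Strict Implicit.
Unset Printing Implicit Defensive.
Import GRing.Theory.
Local Open Scope ring_scope.

Lemma big_dvdn_nat (T : Type) (idx : T) (op : Monoid.law idx) m n (F : nat -> T) :
  (0 < m)%N ->
  \big[op/idx]_(0 <= i < n | (m %| i.+1)%N) F i.+1 =
  \big[op/idx]_(0 <= j < n %/ m) F (m * j.+1)%N.
Proof.
move=> m_gt0; elim: n => [|n IHn]; first by rewrite div0n !big_geq.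
rewrite divnS // big_mkcond big_nat_recr //= -big_mkcond IHn.
case: ifP => [dvd_n|_]; last by rewrite Monoid.mulm1.
rewrite add1n big_nat_recr //=; congr (op _ (F _)).
by have := divnK dvd_n; rewrite divnS // dvd_n; lia.
Qed.

(** * Gauss's product *)

Section Gauss.
Variables (R : comNzRingType) (x : R).

Definition prod_plus (n : nat) : R := \prod_(0 <= i < n) (1 + x ^+ i.+1).
Definition prod_minus (m n : nat) : R := \prod_(m <= i < n) (1 - x ^+ i.+1).
Definition theta (n : nat) : R :=
  1 + 2 * \sum_(0 <= s < n) (-1) ^+ s.+1 * x ^+ (s.+1 * s.+1).
(** Cofactor of [x ^+ n.+1] in the exact error of the finite identity. It is polynomial in [x], so
    the error has order at least [n.+1] in [x]. *)
Definition theta_tail (n : nat) : R :=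
  \sum_(0 <= s < n)
    2 * (-1) ^+ s.+1 * x ^+ (s * n.+1) * prod_plus s * prod_minus s.+1 n.

Lemma prod_plusS n : prod_plus n.+1 = prod_plus n * (1 + x ^+ n.+1).
Proof. by rewrite /prod_plus big_nat_recr. Qed.

Lemma prod_minusS m n : (m <= n)%N ->
  prod_minus m n.+1 = prod_minus m n * (1 - x ^+ n.+1).
Proof. by move=> le_mn; rewrite /prod_minus big_nat_recr. Qed.

Lemma prod_minusnn n : prod_minus n n = 1.
Proof. by rewrite /prod_minus big_geq. Qed.

Lemma prod_minus_ltn m n : (m < n)%N ->
  prod_minus m n = (1 - x ^+ m.+1) * prod_minus m.+1 n.
Proof. by move=> lt_mn; rewrite /prod_minus big_ltn. Qed.

(** Compared term by term, the two sums differ by the increments of the explicit sequence [f], so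
    only boundary values of [f] and one new summand remain. *)
Lemma theta_tailS n :
  x ^+ n.+2 * theta_tail n.+1 =
    (1 + x ^+ n.+1) * (x ^+ n.+1 * theta_tail n)
    + 2 * (-1) ^+ n.+1 * x ^+ (n.+1 * n.+1) * prod_plus n.+1
    + 2 * x ^+ n.+1 * prod_minus 0 n.
Proof.
pose f s := - (2 * (-1) ^+ s * x ^+ (s.+1 * n.+1) * prod_plus s * prod_minus s n).
have tele s : (0 <= s < n)%N ->
    x ^+ n.+2 * (2 * (-1) ^+ s.+1 * x ^+ (s * n.+2) * prod_plus s * prod_minus s.+1 n.+1)
    - (1 + x ^+ n.+1) * (x ^+ n.+1 *
      (2 * (-1) ^+ s.+1 * x ^+ (s * n.+1) * prod_plus s * prod_minus s.+1 n))
    = f s.+1 - f s.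
  case/andP=> _ lt_sn; rewrite /f prod_plusS (prod_minus_ltn lt_sn).
  rewrite prod_minusS // !(mulSn _ n.+1) mulnS !exprD !exprS.
  by ring.
have := telescope_sumr_eq f _ (leq0n n) tele; rewrite sumrB -!mulr_sumr.
rewrite -/(theta_tail n) => /eqP; rewrite subr_eq => /eqP def_sum.
(* The new summand [s = n] and [f n] merge through the factor [1 + x ^+ n.+1] into the square term;
   [- f 0] is the term in [prod_minus 0 n]. *)
rewrite {1}/theta_tail big_nat_recr //= mulrDr def_sum /f.
rewrite !prod_minusnn prod_plusS [prod_plus 0]big_geq // mul1n.
rewrite !mulnS !mulSn !exprD !exprS expr0.
by ring.
Qed.

(* The finite form of Gauss's [phi(-x) = prod (1 - x^i) / (1 + x^i)], with
   denominators cleared. *)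
Lemma theta_prod n :
  prod_plus n * theta n = prod_minus 0 n + x ^+ n.+1 * theta_tail n.
Proof.
elim: n => [|n IHn].
  by rewrite /prod_plus /theta /theta_tail prod_minusnn !big_geq //; ring.
rewrite theta_tailS /theta big_nat_recr // -/(prod_plus n) /=.
have -> : 1 + 2 * (\sum_(0 <= s < n) (-1) ^+ s.+1 * x ^+ (s.+1 * s.+1) +
   (-1) ^+ n.+1 * x ^+ (n.+1 * n.+1)) = theta n + 2 * ((-1) ^+ n.+1 * x ^+ (n.+1 * n.+1)).
  by rewrite /theta; ring.
rewrite mulrDr prod_plusS prod_minusS //.
have -> : prod_plus n * (1 + x ^+ n.+1) * theta n =
    (1 + x ^+ n.+1) * (prod_plus n * theta n).
  by ring.
(* The square terms agree, and [1 + x ^+ n.+1] splits as [(1 - x ^+ n.+1) + 2 * x ^+ n.+1]. *)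
by rewrite IHn; ring.
Qed.
End Gauss.

(** * Power series and truncations *)

(** Congruence modulo ['X^N]. Series identities are proved on truncations, where the ring laws of
    [{poly R}] apply. *)
Definition eq_upto (R : nzRingType) (N : nat) (p q : {poly R}) : Prop :=
  forall i, (i < N)%N -> p`_i = q`_i.

Section Series.
Variable R : comUnitRingType.
Implicit Types (f g h : nat -> R) (p q : {poly R}).

Definition trunc (N : nat) f : {poly R} := \poly_(i < N) f i.

Lemma coef_trunc N f i : (i < N)%N -> (trunc N f)`_i = f i.
Proof. by move=> lt_iN; rewrite coef_poly lt_iN. Qed.

Lemma eq_uptoM N p p' q q' :
  eq_upto N p p' -> eq_upto N q q' -> eq_upto N (p * q) (p' * q').
Proof.
move=> eq_p eq_q i lt_iN; rewrite !coefM; apply: eq_bigr => j _.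
by rewrite eq_p ?eq_q //; have := ltn_ord j; lia.
Qed.

Lemma eq_upto_prod N (r : seq nat) (F G : nat -> {poly R}) :
  (forall i, eq_upto N (F i) (G i)) ->
  eq_upto N (\prod_(i <- r) F i) (\prod_(i <- r) G i).
Proof.
move=> eq_FG; elim: r => [|i r IHr]; first by rewrite !big_nil.
by rewrite !big_cons; apply: eq_uptoM.
Qed.

Lemma eq_upto_refl N p : eq_upto N p p. Proof. by []. Qed.

Lemma eq_upto_trans N p q r :
  eq_upto N p q -> eq_upto N q r -> eq_upto N p r.
Proof. by move=> pq qr i lt_iN; rewrite pq ?qr. Qed.

Lemma eq_upto_sym N p q : eq_upto N p q -> eq_upto N q p.
Proof. by move=> pq i lt_iN; rewrite pq. Qed.

Lemma eq_upto_addXn N M p q : (N <= M)%N -> eq_upto N (p + 'X^M * q) p.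
Proof.
move=> le_NM i lt_iN; rewrite coefD coefXnM.
by rewrite (leq_trans lt_iN le_NM) addr0.
Qed.

Lemma psmul_trunc N f g : eq_upto N (trunc N (psmul f g)) (trunc N f * trunc N g).
Proof.
move=> i lt_iN; rewrite coef_trunc // coefM; apply: eq_bigr => j _.
by rewrite !coef_trunc //; have := ltn_ord j; lia.
Qed.

Lemma psmul_coef N f g n : (n < N)%N -> psmul f g n = (trunc N f * trunc N g)`_n.
Proof. by move=> lt_nN; rewrite -psmul_trunc // coef_trunc. Qed.

Lemma trunc_psone N : eq_upto N (trunc N (@psone R)) 1.
Proof. by move=> i lt_iN; rewrite coef_trunc // coef1. Qed.

Lemma trunc_psexp N f k :
  eq_upto N (trunc N (psexp f k)) (trunc N f ^+ k).
Proof.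
elim: k => [|k IHk]; first exact: trunc_psone.
rewrite exprS; apply: eq_upto_trans (@psmul_trunc _ _ _) _.
exact: eq_uptoM.
Qed.

Lemma psmulC f g n : psmul f g n = psmul g f n.
Proof. by rewrite !(psmul_coef _ _ (ltnSn n)) mulrC. Qed.

Lemma psmulA f g h n : psmul f (psmul g h) n = psmul (psmul f g) h n.
Proof.
rewrite !(psmul_coef _ _ (ltnSn n)).
have := eq_uptoM (@eq_upto_refl n.+1 (trunc n.+1 f)) (@psmul_trunc n.+1 g h).
move=> -> //; rewrite mulrA; apply/esym.
by have /(_ n (ltnSn n)) :=
  eq_uptoM (@psmul_trunc n.+1 f g) (@eq_upto_refl n.+1 (trunc n.+1 h)).
Qed.

Lemma psmul1 f n : psmul (@psone R) f n = f n.
Proof.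
rewrite /psmul big_ord_recl subn0 mul1r big1 ?addr0 // => i _.
by rewrite /psone mul0r.
Qed.

Lemma eq_psmul f f' g g' : f =1 f' -> g =1 g' -> psmul f g =1 psmul f' g'.
Proof. by move=> eq_f eq_g n; apply: eq_bigr => i _; rewrite eq_f eq_g. Qed.

Lemma eq_upto_cancel N p q s : eq_upto N (s * p) (s * q) -> s`_0 = 1 ->
  eq_upto N p q.
Proof.
move=> eq_sp s0 n; elim/ltn_ind: n => n IHn lt_nN.
have := eq_sp n lt_nN; rewrite !coefM !big_ord_recl s0 !mul1r subn0.
rewrite (eq_bigr (fun i : 'I_n => s`_(lift ord0 i) * q`_(n - lift ord0 i))).
  exact: addIr.
by move=> i _; rewrite IHn //= /bump /=; have := ltn_ord i; lia.
Qed.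

Lemma psinv_unique f g : f 0%N \is a GRing.unit ->
  psmul f g =1 @psone R -> g =1 psinv f.
Proof.
move=> Uf fg1 n; have fi1 m : psmul f (psinv f) m = psone R m.
  by rewrite psmulC psmulVf.
rewrite -(psmul1 g n) -(eq_psmul fi1 (frefl g)) psmulC psmulA.
rewrite (eq_psmul (g' := psinv f) (f' := @psone R)) ?psmul1 // => m.
by rewrite psmulC fg1.
Qed.

Lemma psinvM f g : f 0%N \is a GRing.unit -> g 0%N \is a GRing.unit ->
  psinv (psmul f g) =1 psmul (psinv f) (psinv g).
Proof.
move=> Uf Ug n; apply/esym; apply: psinv_unique => {n}.
  by rewrite /psmul big_ord1 unitrM Uf.
move=> n.
rewrite (eq_psmul (g' := psmul (psinv g) (psinv f)) (f' := psmul f g)) //;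
  last by move=> m; rewrite psmulC.
rewrite -psmulA (eq_psmul (f' := f) (g' := psinv f)) // => [|m].
  by rewrite psmulC psmulVf.
rewrite psmulA (eq_psmul (f' := @psone R) (g' := psinv f)) ?psmul1 // => k.
by rewrite psmulC psmulVf.
Qed.

(** * Substitution of powers of q, and dissection *)

Lemma psmul_pscompl m f g n : (0 < m)%N ->
  psmul (pscomp 1 m f) g n = \sum_(0 <= j < (n %/ m).+1) f j * g (n - m * j)%N.
Proof.
move=> m_gt0; rewrite /psmul.
rewrite -(big_mkord xpredT (fun i => pscomp 1 m f i * g (n - i)%N)).
rewrite big_nat_recl // [RHS]big_nat_recl // muln0; congr (_ + _).
  by rewrite /pscomp dvdn0 div0n expr0 mul1r.
have := big_dvdn_nat +%R n (fun i => f (i %/ m)%N * g (n - i)%N) m_gt0.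
rewrite [in RHS](eq_bigr (fun j => f j.+1 * g (n - m * j.+1)%N)) => [<-|j _].
  rewrite [RHS]big_mkcond; apply: eq_bigr => i _.
  by rewrite /pscomp; case: ifP; rewrite ?mul0r // expr1n mul1r.
by rewrite mulKn.
Qed.

(** Multiplying by a series in q^(d l) preserves residue classes of exponents modulo [d], so
    extracting the class [r] acts on [f] alone and replaces q^d by q. *)
Lemma psmul_dissect d r l f g n : (0 < l)%N -> (r < d)%N ->
  psmul f (pscomp 1 (d * l) g) (d * n + r)%N =
  psmul (fun k => f (d * k + r)%N) (pscomp 1 l g) n.
Proof.
move=> l_gt0 lt_rd; have d_gt0 : (0 < d)%N by lia.
rewrite psmulC [RHS]psmulC !psmul_pscompl ?muln_gt0 ?d_gt0 //.
have -> : ((d * n + r) %/ (d * l) = n %/ l)%N.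
  by rewrite divnMA mulnC divnMDl // [(r %/ d)%N]divn_small // addn0.
apply: eq_big_nat => j /andP[_]; rewrite ltnS leq_divRL // => le_jl.
by congr (_ * f _); nia.
Qed.

Lemma pscompM m f g : (0 < m)%N ->
  psmul (pscomp 1 m f) (pscomp 1 m g) =1 pscomp 1 m (psmul f g).
Proof.
move=> m_gt0 n; rewrite psmul_pscompl // /pscomp; case: ifP => [/dvdnP[k ->]|ndvd].
  rewrite mulnK // expr1n mul1r /psmul big_mkord; apply: eq_bigr => j _.
  have le_jk : (j <= k)%N by rewrite -ltnS.
  by rewrite mulnC -mulnBr dvdn_mulr // mulKn // expr1n mul1r.
rewrite big1_seq // => j /andP[_]; rewrite mem_index_iota ltnS leq_divRL // => le_jm.
by rewrite dvdn_subl ?dvdn_mulr ?ndvd ?mulr0 // mulnC.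
Qed.

Lemma psinv_pscomp m f : (0 < m)%N -> f 0%N \is a GRing.unit ->
  psinv (pscomp 1 m f) =1 pscomp 1 m (psinv f).
Proof.
move=> m_gt0 Uf n; apply/esym; apply: psinv_unique => {n}.
  by rewrite /pscomp dvdn0 div0n expr0 mul1r.
move=> n; rewrite pscompM // /pscomp psmulC psmulVf // /psone.
case: ifP => [/dvdnP[k ->]|]; last by case: n => //; rewrite dvdn0.
by rewrite mulnK // expr1n mul1r muln_eq0 (negPf (lt0n_neq0 m_gt0)) orbF.
Qed.
End Series.

(** * Squares and theta functions *)

(** Excluding the root 0 makes this the coefficient of b in phi = 1 + 2 b. *)
Definition possq (n : nat) : bool := [exists j : 'I_n.+1, (0 < j)%N && (n == j * j)%N].

Lemma possqP n : reflect (exists2 j, (0 < j)%N & n = (j * j)%N) (possq n).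
Proof.
apply: (iffP existsP) => [[j /andP[j_gt0 /eqP def_n]]|[j j_gt0 def_n]].
  by exists j.
have lt_jn : (j < n.+1)%N by rewrite def_n ltnS leq_pmulr.
by exists (Ordinal lt_jn); rewrite j_gt0 /= -def_n eqxx.
Qed.

Lemma possq0 : possq 0 = false.
Proof. by apply/possqP => -[j]; case: j. Qed.

(** A root of [2 * k] is even, say 2 i, and then k = 2 i^2. *)
Lemma possq_double k : possq (2 * k) = (~~ odd k && possq k./2).
Proof.
apply/possqP/andP => [[j j_gt0 def_j]|[even_k /possqP[j j_gt0 def_k]]]; last first.
  by exists j.*2; have := odd_double_half k; lia.
have odd_j : odd j = false by have := congr1 odd def_j; rewrite !oddM andbb.
have def_k : k = (2 * (j./2 * j./2))%N by have := odd_double_half j; rewrite odd_j; nia.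
split; first by rewrite def_k oddM.
apply/possqP; exists j./2; first by have := odd_double_half j; rewrite odd_j; lia.
by rewrite {1}def_k mul2n doubleK.
Qed.

Lemma possq_mul3 k : possq (3 * k) = (3 %| k)%N && possq (k %/ 3).
Proof.
apply/possqP/andP => [[j j_gt0 def_j]|[/dvdnP[i ->] /possqP[j j_gt0 def_i]]]; last first.
  by rewrite mulnK // in def_i; exists (3 * j)%N; nia.
have /dvdnP[i def_i] : (3 %| j)%N.
  have := Euclid_dvdM j j (isT : prime 3).
  by rewrite -def_j dvdn_mulr // orbb => <-.
have def_k : k = (i * i * 3)%N by nia.
rewrite def_k dvdn_mull // mulnK //; split=> //; apply/possqP; exists i => //; nia.
Qed.

(** At most one term is nonzero; the sign depends on [m] alone because a number and its square have
    the same parity. *)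
Lemma sum_sign_square m k : (m <= k)%N ->
  \sum_(0 <= s < k) (-1) ^+ s.+1 * (m == s.+1 * s.+1)%N%:R =
    (-1) ^+ m * (possq m)%:R :> int.
Proof.
move=> le_mk; case: possqP => [[j j_gt0 def_m]|not_sq]; last first.
  rewrite big1 ?mulr0 // => s _; case: eqP => [def_m|]; last by rewrite mulr0.
  by case: not_sq; exists s.+1.
have lt_jk : (j.-1 < k)%N by nia.
rewrite big_mkord (bigD1 (Ordinal lt_jk)) //= prednK // def_m eqxx.
rewrite big1 ?addr0 => [|i]; first by rewrite !mulr1 -[RHS]signr_odd oddM andbb signr_odd.
rewrite -val_eqE /= => ne_ij; case: eqP => [eq_sq|]; last by rewrite mulr0.
by case/eqP: ne_ij; nia.
Qed.

Lemma sum_square m k : (m <= k)%N ->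
  \sum_(0 <= s < k) (m == s.+1 * s.+1)%N%:R = (possq m)%:R :> int.
Proof.
move=> le_mk; have := congr1 ( *%R ((-1) ^+ m)) (sum_sign_square le_mk).
rewrite mulrA -expr2 sqrr_sign mul1r => <-; rewrite mulr_sumr; apply: eq_bigr => s _.
case: eqP => [->|]; last by rewrite !mulr0.
by rewrite mulr1 -signr_odd oddM andbb signr_odd -expr2 sqrr_sign.
Qed.

(** The middle index [i = n] is j = 0; the indices on either side are the negative and the positive
    j, and each side contributes [possq n]. *)
Lemma phiE n : phi n = (n == 0%N)%:R + 2 * (possq n)%:R.
Proof.
pose F i : int := ((i%:Z - n%:Z) ^+ 2 == n%:Z)%:R.
have -> : phi n = \sum_(0 <= i < n.*2.+1) F i.
  by rewrite big_mkord /phi big_mkcond /=; apply: eq_bigr => i _; rewrite /F; case: eqP.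
have sq_eq (z : int) (j : nat) : z = j%:Z \/ z = - j%:Z ->
    (z ^+ 2 == n%:Z) = (n == j * j)%N.
  have -> : (n == j * j)%N = (j%:Z ^+ 2 == n%:Z).
    by rewrite expr2 -PoszM eqz_nat eq_sym.
  by case=> ->; rewrite ?sqrrN.
rewrite (@big_cat_nat _ _ _ n) //=; last by lia.
rewrite [X in _ + X]big_ltn; last by lia.
rewrite {1}big_nat_rev /= -{1}[n.+1]add0n big_addn.
have -> : (n.*2.+1 - n.+1 = n)%N by lia.
rewrite [X in X + _](eq_big_nat _ _ (F2 := fun s => (n == s.+1 * s.+1)%N%:R)); last first.
  by move=> i /andP[_ lt_in]; rewrite /F (sq_eq _ i.+1) //; right; lia.
rewrite [X in _ + (_ + X)](eq_bigr (fun s => (n == s.+1 * s.+1)%N%:R)); last first.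
  by move=> i _; rewrite /F (sq_eq _ i.+1) //; left; lia.
rewrite sum_square // /F subrr expr0n /= -[0%:R]/(0%:Z) eqz_nat eq_sym.
by ring.
Qed.

(* [8 k (k + 1) / 2 + 1 = (2 k + 1)^2]. *)
Lemma psiE n : psi n = (possq (8 * n).+1)%:R.
Proof.
have sq_iff : reflect (exists k, (k * k.+1 = n * 2)%N) (possq (8 * n).+1).
  apply: (iffP (possqP _)) => [[j j_gt0 def_j]|[k def_k]]; last by exists k.*2.+1 => //; nia.
  have odd_j : odd j by have := congr1 odd def_j; rewrite oddS !oddM andbb.
  by exists j./2; have := odd_double_half j; rewrite odd_j; nia.
have tri i : ((i * i.+1) %/ 2 == n)%N = (i * i.+1 == n * 2)%N.
  have dvd2 : (2 %| i * i.+1)%N by rewrite dvdn2 oddM /= andbN.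
  by rewrite eq_sym eqn_div // eq_sym.
rewrite /psi (eq_bigl _ _ (fun i : 'I_n.+1 => tri i)).
case: sq_iff => [[k def_k]|no_k].
  have lt_kn : (k < n.+1)%N by nia.
  rewrite (big_pred1 (Ordinal lt_kn)) // => i /=; rewrite -val_eqE /=.
  by apply/eqP/eqP; nia.
by rewrite big1 // => i /eqP def_i; case: no_k; exists i.
Qed.

(** * Congruences *)

(** Exhibiting the quotients turns congruences into identities accessible to [ring]. *)
Lemma pscongP m (f g : nat -> int) :
  pscong m f g <-> exists r : nat -> int, forall n, f n = g n + m%:Z * r n.
Proof.
split=> [fg|[r def_f] n]; last by rewrite def_f addrC mulrC modzMDl.
exists (fun n => ((f n - g n) %/ m%:Z)%Z) => n.
have /dvdzP[k def_k] : (m%:Z %| f n - g n)%Z by rewrite -eqz_mod_dvd; apply/eqP.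
by rewrite mulrC divzK; [ring | apply/dvdzP; exists k].
Qed.

Lemma pscong_mull m (f g h : nat -> int) :
  pscong m f g -> pscong m (psmul f h) (psmul g h).
Proof.
move/pscongP=> [r def_f]; apply/pscongP; exists (psmul r h) => n.
rewrite /psmul mulr_sumr -big_split; apply: eq_bigr => i _ /=.
by rewrite def_f; ring.
Qed.

Lemma pscong_trans m (f g h : nat -> int) :
  pscong m f g -> pscong m g h -> pscong m f h.
Proof. by move=> fg gh n; rewrite fg. Qed.

Lemma pscong_sym m (f g : nat -> int) : pscong m f g -> pscong m g f.
Proof. by move=> fg n; rewrite fg. Qed.

Lemma pscong_dvd m k (f g : nat -> int) : (k %| m)%N -> pscong m f g -> pscong k f g.
Proof.
move=> /dvdnP[c ->] /pscongP[r def_f]; apply/pscongP; exists (fun n => c%:Z * r n) => n.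
by rewrite def_f PoszM; ring.
Qed.

Lemma eq_pscong m (f f' g g' : nat -> int) :
  f =1 f' -> g =1 g' -> pscong m f' g' -> pscong m f g.
Proof. by move=> ff' gg' fg n; rewrite ff' gg'. Qed.

Lemma pscong_inv m (f g : nat -> int) : f 0%N \is a GRing.unit ->
  pscong m (psmul f g) (psone int) -> pscong m g (psinv f).
Proof.
move=> Uf /(pscong_mull (psinv f)) fg1.
apply: eq_pscong fg1 => n; last by rewrite psmul1.
rewrite psmulC psmulA -[LHS]psmul1; apply: eq_psmul => // k.
by rewrite psmulVf.
Qed.

(* [(1 + 2 g)^4 = 1] modulo 8. *)
Lemma psexp3_inv (f g : nat -> int) :
  (forall n, f n = psone int n + 2 * g n) -> f 0%N \is a GRing.unit ->
  pscong 8 (psexp f 3) (psinv f).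
Proof.
move=> def_f Uf; apply: pscong_inv => //; apply/pscongP.
(* [w] is ((1 + 2 p)^4 - 1) / 8, from the binomial expansion. *)
pose p N := trunc N g; pose w N := p N + 3 * p N ^+ 2 + 4 * p N ^+ 3 + 2 * p N ^+ 4.
exists (fun n => (w n.+1)`_n) => n.
have trunc_f : eq_upto n.+1 (trunc n.+1 f) (1 + 2 * p n.+1).
  by move=> i lt_in; rewrite coefD coef1 mulr_natl coefMn !coef_trunc // def_f mulr_natl.
rewrite (psmul_coef _ _ (ltnSn n)).
rewrite (eq_uptoM trunc_f (@trunc_psexp _ n.+1 f 3)) //.
have f3 : eq_upto n.+1 (trunc n.+1 f ^+ 3) ((1 + 2 * p n.+1) ^+ 3).
  exact: eq_uptoM trunc_f (eq_uptoM trunc_f trunc_f).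
rewrite (eq_uptoM (@eq_upto_refl _ n.+1 (1 + 2 * p n.+1)) f3) //.
have -> : (1 + 2 * p n.+1) * (1 + 2 * p n.+1) ^+ 3 = 1 + w n.+1 *+ 8.
  by rewrite /w; ring.
by rewrite coefD coef1 coefMn -[_ *+ 8]mulr_natl.
Qed.

(** The terms of index [i] and [n - i] are equal and cancel modulo 2 in pairs; only the middle term,
    present for even [n], survives. *)
Lemma psmul_sqr_mod2 (f : nat -> int) :
  pscong 2 (psmul f f) (fun n => if odd n then 0 else f n./2 ^+ 2).
Proof.
apply/pscongP; exists (fun n => \sum_(0 <= i < uphalf n) f i * f (n - i)%N) => n.
have shift a b (F : nat -> int) :
    \sum_(a <= i < b) F i = \sum_(0 <= i < b - a) F (i + a)%N.
  by rewrite -{1}[a]add0n big_addn.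
rewrite /psmul -(big_mkord xpredT (fun i => f i * f (n - i)%N)).
rewrite (@big_cat_nat _ _ _ (uphalf n)) //=; last by lia.
have def_n := odd_double_half n; have := uphalf_half n.
case: (odd n) def_n => /= def_n def_u.
  rewrite [X in _ + X]big_nat_rev /= [X in _ + X]shift.
  have -> : (n.+1 - uphalf n = uphalf n)%N by lia.
  rewrite (eq_big_nat _ _ (F1 := fun i => f (_ - _)%N * _) (F2 := fun i => f i * f (n - i)%N)).
    by ring.
  move=> i /andP[_ lt_i]; rewrite mulrC; congr (f _ * f _); lia.
rewrite [X in _ + X]big_ltn; last by lia.
rewrite [X in _ + (_ + X)]big_nat_rev /= [X in _ + (_ + X)]shift.
have -> : (n.+1 - (uphalf n).+1 = uphalf n)%N by lia.
rewrite [X in _ + (_ + X)](eq_big_nat _ _ (F2 := fun i => f i * f (n - i)%N)).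
  have -> : (n - uphalf n = n./2)%N by lia.
  by rewrite def_u; ring.
by move=> i /andP[_ lt_i]; rewrite mulrC; congr (f _ * f _); lia.
Qed.

(** * The reciprocal of phi(-q) modulo 8 *)

Definition phi_neg : nat -> int := pscomp (-1) 1 phi.
(* From [1 / (1 + 2 b) = 1 - 2 b + 4 b^2] modulo 8, where [b(q)^2 = b(q^2)]
   modulo 2. *)
Definition recip8 (n : nat) : int :=
  psone int n - 2 * ((-1) ^+ n * (possq n)%:R)
  + 4 * (~~ odd n && possq n./2)%:R.

Lemma phi_negE n : phi_neg n = psone int n + 2 * ((-1) ^+ n * (possq n)%:R).
Proof.
rewrite /phi_neg /pscomp dvd1n divn1 phiE mulrDr mulrCA /psone; congr (_ + _).
by case: n => [|n]; rewrite ?mulr0 // mul1r.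
Qed.

Lemma phi_neg0 : phi_neg 0 = 1.
Proof. by rewrite phi_negE possq0 !mulr0 addr0. Qed.

(** With e(q) the reduction of b(q^2) modulo 2, (1 + 2 b)(1 - 2 b + 4 e) = 1 + 4 (e - b^2) + 8 b e,
    and b^2 is congruent to e modulo 2. *)
Lemma psinv_phi_neg8 : pscong 8 (psinv phi_neg) recip8.
Proof.
apply/pscong_sym/pscong_inv; first by rewrite phi_neg0 unitr1.
pose b n : int := (-1) ^+ n * (possq n)%:R.
pose e n : int := (~~ odd n && possq n./2)%:R.
have /pscongP[r bb] := psmul_sqr_mod2 b; apply/pscongP.
(* As b^2 = e + 2 r, the term 4 (e - b^2) is - 8 r. *)
exists (fun n => psmul b e n - r n) => n; set N := n.+1.
have trunc_phi : eq_upto N (trunc N phi_neg) (1 + 2 * trunc N b).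
  by move=> i lt_iN; rewrite coefD coef1 mulr_natl coefMn !coef_trunc // phi_negE mulr_natl.
have trunc_c : eq_upto N (trunc N recip8) (1 - 2 * trunc N b + 4 * trunc N e).
  move=> i lt_iN; rewrite !coefD coefN coef1 !mulr_natl !coefMn !coef_trunc //.
  by rewrite /recip8 !mulr_natl.
rewrite (psmul_coef _ _ (ltnSn n)) (eq_uptoM trunc_phi trunc_c) //.
have -> : (1 + 2 * trunc N b) * (1 - 2 * trunc N b + 4 * trunc N e) =
  1 + (trunc N e - trunc N b * trunc N b) *+ 4 + (trunc N b * trunc N e) *+ 8 by ring.
rewrite 2!coefD 2!coefMn coefD coefN -!psmul_coef // bb coef1 coef_trunc //.
have -> : (if odd n then 0 else b n./2 ^+ 2) = e n.
  rewrite /e /b; case: (odd n) => //=; rewrite exprMn -exprM mulnC exprM sqrrN !expr1n mul1r.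
  by case: (possq _).
by rewrite -[psone int n]/((n == 0%N)%:R); ring.
Qed.

(** Absorbing the sign into [phi_neg] leaves the plain substitution of q^l for q, which commutes
    with inversion and fits the dissection lemma. *)
Lemma psinv_pscomp_phi l : (0 < l)%N ->
  psinv (pscomp (-1) l phi) =1 pscomp 1 l (psinv phi_neg).
Proof.
move=> l_gt0 n.
have comp_phi : pscomp (-1) l phi =1 pscomp 1 l phi_neg.
  move=> k; rewrite /phi_neg /pscomp; case: ifP => // _.
  by rewrite dvd1n divn1 expr1n mul1r.
rewrite -psinv_pscomp ?phi_neg0 ?unitr1 //; apply/esym/psinv_unique => {n}.
  by rewrite comp_phi /pscomp dvdn0 div0n phi_neg0 expr1n mulr1 unitr1.
move=> n; rewrite (eq_psmul comp_phi (frefl _)) psmulC psmulVf //.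
by rewrite /pscomp dvdn0 div0n phi_neg0 expr1n mulr1 unitr1.
Qed.

(** * The generating function of overpartitions *)

(* With [x = q^i], the contribution of the parts equal to [i] in one colour;
   the factor 2 is the choice of overlining. *)
Definition part_poly (R : nzRingType) (n : nat) (x : R) : R :=
  1 + 2 * \sum_(0 <= k < n) x ^+ k.+1.

(** Each pair of a size and a colour contributes the sum over its admissible multiplicities and
    bits. Distributing the product over these sums gives one monomial per admissible [F], of degree
    the total size. *)
Lemma overp_coef l n :
  (overp l n)%:Z = ((\prod_(0 <= i < n) part_poly n ('X^(i.+1) : {poly int})) *
     (\prod_(0 <= i < n | (l %| i.+1)%N) part_poly n 'X^(i.+1)))`_n.
Proof.
pose ok (x : 'I_n * bool) (y : 'I_n.+1 * bool) :=
  (y.2 ==> (0 < y.1)%N) && (x.2 ==> ((0 < y.1)%N ==> (l %| x.1.+1)%N)).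
pose wt (x : 'I_n * bool) (y : 'I_n.+1 * bool) := (x.1.+1 * y.1)%N.
have okE F : [forall x, ok x (F x)] = [forall x, (F x).2 ==> (0 < (F x).1)%N]
    && [forall i, (0 < (F (i, true)).1)%N ==> (l %| i.+1)%N].
  apply/forallP/andP => [okF|[/forallP ok1 /forallP ok2] [i c]].
    split; apply/forallP => x; first by case/andP: (okF x).
    by case/andP: (okF (x, true)).
  by rewrite /ok ok1 /=; case: c => //=.
have sum_ok x : \sum_y (ok x y)%:R * 'X^(wt x y) =
    if x.2 ==> (l %| x.1.+1)%N then part_poly n ('X^(x.1.+1) : {poly int}) else 1.
  case: x => i c; rewrite (eq_bigr (fun y =>
    (ok (i, c) (y.1, y.2))%:R * 'X^(wt (i, c) (y.1, y.2)))); last by case.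
  rewrite -(pair_bigA _ (fun k b => (ok (i, c) (k, b))%:R * 'X^(wt (i, c) (k, b)))) /=.
  (* Multiplicity 0 admits only the bit [false]; an allowed positive multiplicity admits both bits,
     whence the factor 2. *)
  rewrite big_ord_recl big_bool /ok /wt /= implybT mul0r add0r muln0 mul1r expr0.
  under eq_bigr => k _ do rewrite big_bool /= /bump add1n exprM.
  case: ifP => _; last by rewrite big1 ?addr0 // => k _; rewrite mul0r addr0.
  rewrite /part_poly big_mkord mulr_sumr; congr (_ + _); apply: eq_bigr => k _.
  by rewrite -mulrDl.
have -> : (\prod_(0 <= i < n) part_poly n ('X^(i.+1) : {poly int})) *
     (\prod_(0 <= i < n | (l %| i.+1)%N) part_poly n 'X^(i.+1)) =
     \prod_x \sum_y (ok x y)%:R * 'X^(wt x y).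
  rewrite (eq_bigr _ (fun x _ => sum_ok x)).
  rewrite -(pair_bigA _ (fun (i : 'I_n) c =>
    if c ==> (l %| i.+1)%N then part_poly n ('X^(i.+1) : {poly int})
    else 1)) /=.
  under [RHS]eq_bigr => i _ do rewrite big_bool /= mulrC.
  by rewrite big_split /= -big_mkcond !big_mkord.
rewrite bigA_distr_bigA /= coef_sum /overp -sum1_card.
rewrite (eq_bigl (fun F => overpartition2 l F)); last by move=> F; rewrite inE.
rewrite -[LHS]natz natr_sum big_mkcond; apply: eq_bigr => F _.
have [okF|not_okF] := boolP [forall x, ok x (F x)]; last first.
  have -> : overpartition2 l F = false.
    by apply/negbTE; apply: contra not_okF; rewrite okE => /and3P[-> -> _].
  have [x not_ok_x] := forallPn not_okF.
  by rewrite (bigD1 x) //= (negbTE not_ok_x) !mul0r coef0.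
rewrite (eq_bigr (fun x => 'X^(wt x (F x)))); last first.
  by move=> x _; rewrite (forallP okF) mul1r.
rewrite -expr_sum coefXn eq_sym.
move: okF; rewrite /overpartition2 okE => /andP[-> ->] /=.
have -> : (\sum_x wt x (F x) = \sum_(i < n) \sum_(c : bool) i.+1 * (F (i, c)).1)%N.
  rewrite (pair_bigA _ (fun (i : 'I_n) (c : bool) => i.+1 * (F (i, c)).1)%N).
  by apply: eq_bigr => -[].
by case: eqP.
Qed.

(** A geometric sum: [part_poly n x] is (1 + x) / (1 - x) up to order [n.+1] in [x]. *)
Lemma part_poly_mul (R : comNzRingType) n (x : R) :
  (1 - x) * part_poly n x = 1 + x - 2 * x ^+ n.+1.
Proof.
rewrite /part_poly; elim: n => [|n IHn]; first by rewrite big_geq // expr1; ring.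
rewrite big_nat_recr //= [2 * _]mulrDr addrA mulrDr IHn (exprS x n.+1).
by ring.
Qed.

Lemma coef0_prod_plus L k : (0 < L)%N -> (prod_plus ('X^L : {poly int}) k)`_0 = 1.
Proof.
move=> L_gt0; rewrite /prod_plus; elim: k => [|k IHk]; first by rewrite big_geq // coef1.
rewrite big_nat_recr //= coef0M IHk mul1r coefD coef1 -exprM coefXn.
by rewrite [(0 == L * _)%N]ltn_eqF ?muln_gt0 ?L_gt0 // addr0.
Qed.

(** Keeping [n %/ L] terms is enough: [L * (s * s) <= n] forces [s <= n %/ L]. *)
Lemma theta_phi L n : (0 < L)%N ->
  eq_upto n.+1 (theta ('X^L : {poly int}) (n %/ L)) (trunc n.+1 (pscomp (-1) L phi)).
Proof.
move=> L_gt0 m lt_mn; rewrite coef_trunc // /theta coefD coef1 mulr_natl.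
rewrite coefMn coef_sum /pscomp.
have coef_term s : (((-1) ^+ s.+1 * 'X^L ^+ (s.+1 * s.+1) : {poly int})`_m =
    (-1) ^+ s.+1 * (m == L * (s.+1 * s.+1))%N%:R).
  rewrite -exprM -signr_odd -[in RHS]signr_odd !mulr_sign.
  by case: (odd _); rewrite ?coefN coefXn.
rewrite (eq_bigr _ (fun s _ => coef_term s)).
case: ifP => [/dvdnP[t def_m]|ndvd].
  rewrite def_m mulnK // phiE.
  rewrite (eq_bigr (fun s => (-1) ^+ s.+1 * (t == s.+1 * s.+1)%N%:R)) => [|s _]; last first.
    by rewrite mulnC eqn_pmul2l.
  rewrite sum_sign_square; last by rewrite leq_divRL // -def_m.
  rewrite muln_eq0 (negPf (lt0n_neq0 L_gt0)) orbF -[_ *+ 2]mulr_natl mulrDr; congr (_ + _).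
    by case: t {def_m} => [|t]; rewrite ?mulr0 // mul1r.
  by rewrite mulrCA.
rewrite big1 => [|s _]; last first.
  case: eqP => [def_m|]; rewrite ?mulr0 //.
  by rewrite def_m dvdn_mulr in ndvd.
by case: m ndvd {lt_mn coef_term} => //; rewrite dvdn0.
Qed.

(** Modulo ['X^(n.+1)], [prod_minus * A] is [prod_plus] and [prod_plus * theta] is [prod_minus].
    Hence [prod_plus * (theta * A)] is [prod_plus], and cancelling shows that [A] inverts
    [theta]. *)
Lemma prod_part_psinv L n : (0 < L)%N ->
  eq_upto n.+1 (\prod_(0 <= i < n | (L %| i.+1)%N) part_poly n 'X^(i.+1))
    (trunc n.+1 (psinv (pscomp (-1) L phi))).
Proof.
move=> L_gt0; rewrite (big_dvdn_nat _ n (fun i => part_poly n ('X^i : {poly int}))) //.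
set k := (n %/ L)%N; set x : {poly int} := 'X^L; set A := \prod_(_ <= _ < _) _.
have minusA : eq_upto n.+1 (prod_minus x 0 k * A) (prod_plus x k).
  rewrite /prod_minus /A -big_split; apply: eq_upto_prod => i /=.
  rewrite -exprM part_poly_mul -[in X in _ - X]exprM.
  rewrite -mulNr mulrC; apply: eq_upto_addXn; nia.
have theta_prod_upto : eq_upto n.+1 (prod_plus x k * theta x k) (prod_minus x 0 k).
  rewrite theta_prod -exprM; apply: eq_upto_addXn.
  (* The error has order at least [L * (n %/ L).+1], which exceeds [n]. *)
  by rewrite mulnC -ltn_divLR.
have thetaA : eq_upto n.+1 (theta x k * A) 1.
  apply: (eq_upto_cancel (s := prod_plus x k)); last exact: coef0_prod_plus.
  rewrite mulrA mulr1; apply: eq_upto_trans minusA.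
  exact: eq_uptoM.
have theta0 : (theta x k)`_0 = 1.
  by rewrite theta_phi // coef_trunc // /pscomp dvdn0 div0n mul1r phiE possq0 mulr0 addr0.
apply: (eq_upto_cancel (s := theta x k)) => //.
apply: eq_upto_trans thetaA _.
apply: eq_upto_sym.
apply: eq_upto_trans (eq_uptoM (@theta_phi L n L_gt0) (@eq_upto_refl _ _ _)) _.
apply: eq_upto_trans (eq_upto_sym (@psmul_trunc _ _ _ _)) _.
move=> i lt_in; rewrite coef_trunc // coef1 psmulC psmulVf //.
by rewrite /pscomp dvdn0 div0n mul1r phiE possq0 mulr0 addr0 unitr1.
Qed.

Lemma overp_psinv l n : (0 < l)%N ->
  (overp l n)%:Z = psmul (psinv (pscomp (-1) 1 phi)) (psinv (pscomp (-1) l phi)) n.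
Proof.
move=> l_gt0; rewrite overp_coef (psmul_coef _ _ (ltnSn n)).
have := eq_uptoM (@prod_part_psinv 1 n isT) (@prod_part_psinv l n l_gt0).
by move=> <- //; under [in RHS]eq_bigl => i do rewrite dvd1n.
Qed.

(** * Residue classes of the overpartition counts *)

Lemma overp_dissect d r l n : (0 < l)%N -> (r < d)%N ->
  (overp (d * l) (d * n + r))%:Z =
  psmul (fun k => psinv phi_neg (d * k + r)%N) (psinv (pscomp (-1) l phi)) n.
Proof.
move=> l_gt0 lt_rd; have dl_gt0 : (0 < d * l)%N by rewrite muln_gt0 l_gt0; lia.
rewrite overp_psinv // -/phi_neg (eq_psmul (frefl _) (psinv_pscomp_phi dl_gt0)).
rewrite psmul_dissect //; apply: eq_psmul => // k.
by rewrite psinv_pscomp_phi.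
Qed.

Lemma overp_cong m d r l (f : nat -> int) : (0 < l)%N -> (r < d)%N ->
  pscong m (fun k => psinv phi_neg (d * k + r)%N) f ->
  pscong m (fun n => (overp (d * l) (d * n + r))%:Z) (psdiv f (pscomp (-1) l phi)).
Proof.
move=> l_gt0 lt_rd cong_f; apply: pscong_trans (pscong_mull _ cong_f) => n.
by rewrite overp_dissect.
Qed.

Lemma overp_cong0 m d r l : (0 < l)%N -> (r < d)%N ->
  pscong m (fun k => psinv phi_neg (d * k + r)%N) (fun=> 0) ->
  forall n, (overp (d * l) (d * n + r) = 0 %[mod m])%N.
Proof.
move=> l_gt0 lt_rd cong0 n; have := overp_cong l_gt0 lt_rd cong0 n.
rewrite /psdiv /psmul big1 => [|i _]; last by rewrite mul0r.
by rewrite -[0]/(0%:Z) !modz_nat => -[].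
Qed.

(** * Dissections *)

Lemma recip8E n : recip8 n =
  (n == 0%N)%:R + (if odd n then 2 else -2) * (possq n)%:R + 4 * (~~ odd n && possq n./2)%:R.
Proof.
rewrite /recip8 -signr_odd mulr_sign -[psone int n]/((n == 0%N)%:R).
by case: (odd n); ring.
Qed.

Lemma psinv_phi_neg_cong m n : (m %| 8)%N ->
  exists r, psinv phi_neg n = recip8 n + m%:Z * r.
Proof.
move=> /pscong_dvd /(_ psinv_phi_neg8)/pscongP[r def_a].
by exists (r n).
Qed.

(** Modulo 4 the signs of the terms 2 b are immaterial, and an even square is 4 times a square, so
    the even part of 1 / phi(-q) reproduces 1 / phi(-q^2). *)
Lemma psinv_phi_neg_2k :
  pscong 4 (fun k => psinv phi_neg (2 * k + 0)%N) (pscomp 1 2 (psinv phi_neg)).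
Proof.
move=> k; rewrite /pscomp expr1n mul1r addn0 dvdn2 divn2.
have [r ->] := @psinv_phi_neg_cong 4 (2 * k) isT.
have -> : recip8 (2 * k) = (k == 0%N)%:R - 2 * (~~ odd k && possq k./2)%:R + 4 * (possq k)%:R.
  by rewrite recip8E oddM possq_double muln_eq0 mul2n doubleK mulNr.
apply/eqP; rewrite eqz_mod_dvd; apply/dvdzP.
case: ifP => [even_k|odd_k] /=; last first.
  by exists ((possq k)%:R + r); case: k odd_k => //= k _; ring.
have [r' ->] := @psinv_phi_neg_cong 4 k./2 isT.
have -> : (k == 0)%N = (k./2 == 0)%N.
  by have := odd_double_half k; rewrite (negPf even_k); lia.
rewrite recip8E; set b := (~~ odd _ && _)%:R.
(* The second summand compensates for the coefficient 2 in place of -2 in [recip8] when [k./2] is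
   odd. *)
exists ((possq k)%:R - (odd k./2 && possq k./2)%:R - b + r - r').
by case: (odd k./2); rewrite /=; ring.
Qed.

(** At odd exponents [recip8] retains only the squares, with coefficient 2; and 2 k + 1 = (2 m +
    1)^2 means k = 4 (m (m + 1) / 2). *)
Lemma psinv_phi_neg_2kp1 :
  pscong 8 (fun k => psinv phi_neg (2 * k + 1)%N) (psscale 2 (pscomp 1 4 psi)).
Proof.
move=> k; rewrite psinv_phi_neg8 recip8E addn1 /= oddM /=.
rewrite /psscale /pscomp expr1n mul1r psiE mulr0 !addr0 add0r; congr (_ * _ %% _)%Z.
case: ifP => [/dvdnP[j ->]|ndvd]; first by rewrite mulnK //; congr (possq _)%:R; lia.
case: possqP => // -[j j_gt0 def_j]; case/negP: ndvd.
have odd_j : odd j by have := congr1 odd def_j; rewrite oddS !oddM andbb.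
have := odd_double_half j; rewrite odd_j => {}odd_j.
have def_k : k = (2 * (j./2 * (j./2).+1))%N by nia.
by rewrite def_k (@dvdn_pmul2l 2 2) // dvdn2 oddM /= andbN.
Qed.

(** The class 0 modulo 3 of 1 / phi(-q) is 1 / phi(-q^3) modulo 8, as squares divisible by 3 are
    divisible by 9. The cube arises because f^4 is 1 modulo 8 for f = 1 + 2 g. *)
Lemma psinv_phi_neg_3k :
  pscong 8 (fun k => psinv phi_neg (3 * k + 0)%N) (psexp (pscomp (-1) 3 phi) 3).
Proof.
have exp_inv : pscong 8 (psexp (pscomp (-1) 3 phi) 3) (psinv (pscomp (-1) 3 phi)).
  apply: (psexp3_inv (g := fun n =>
    if (3 %| n)%N then (-1) ^+ (n %/ 3) * (possq (n %/ 3))%:R else 0)).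
    move=> n; rewrite /pscomp; case: ifP => [/dvdnP[j ->]|ndvd]; last first.
      by case: n ndvd => //; rewrite dvdn0.
    rewrite mulnK // phiE mulrDr mulrCA /psone muln_eq0 orbF; congr (_ + _).
    by case: j => [|j]; rewrite ?mulr0 // mul1r.
  by rewrite /pscomp dvdn0 phiE possq0 unitr1.
apply: pscong_trans (pscong_sym exp_inv) => k.
rewrite psinv_pscomp_phi // /pscomp expr1n mul1r addn0.
rewrite psinv_phi_neg8; case: ifP => [/dvdnP[j ->]|ndvd]; last first.
  have -> : recip8 (3 * k) = 0; last by [].
  rewrite recip8E possq_mul3 ndvd mulr0 addr0 oddM /=.
  have -> : (3 * k == 0)%N = false by case: k ndvd.
  case: (boolP (odd k)) => //= even_k; have def_k := odd_double_half k.
  rewrite (negPf even_k) add0n in def_k.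
  rewrite -def_k -doubleMr doubleK possq_mul3.
  have -> // : (3 %| k./2)%N = false.
  by apply: contraFF ndvd => dvd_k2; rewrite -def_k -muln2 dvdn_mulr.
rewrite mulnK // psinv_phi_neg8; congr (_ %% _)%Z.
(* Now k = 3 j, and [recip8] agrees at 9 j and j: same parity, and 9 j or its half is a square
   exactly when j or its half is. *)
rewrite !recip8E possq_mul3 dvdn_mull // mulnK // !oddM /= andbT.
rewrite !muln_eq0 orbF; congr (_ + _ + 4 * _%:R).
case: (boolP (odd j)) => //= even_j; have def_j := odd_double_half j.
rewrite (negPf even_j) add0n in def_j.
by rewrite -{1}def_j -doubleMl -doubleMr doubleK possq_mul3 dvdn_mull // mulnK.
Qed.

(** Modulo 2 the series 1 / phi(-q) is 1, so every positive exponent has an even coefficient. *)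
Lemma psinv_phi_neg_3kp1 :
  pscong 2 (fun k => psinv phi_neg (3 * k + 1)%N) (fun=> 0).
Proof.
move=> k; have [r ->] := @psinv_phi_neg_cong 2 (3 * k + 1) isT.
apply/eqP; rewrite eqz_mod_dvd recip8E addn1 add0r subr0; apply/dvdzP.
case: (odd _).
  by exists ((possq (3 * k).+1)%:R + 2 * (~~ true && possq (3 * k).+1./2)%:R + r); ring.
by exists (- (possq (3 * k).+1)%:R + 2 * (~~ false && possq (3 * k).+1./2)%:R + r); ring.
Qed.

(** No square is 2 modulo 3, so only the term of [recip8] with coefficient 4 can remain. *)
Lemma psinv_phi_neg_3kp2 :
  pscong 4 (fun k => psinv phi_neg (3 * k + 2)%N) (fun=> 0).
Proof.
move=> k; have [r ->] := @psinv_phi_neg_cong 4 (3 * k + 2) isT.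
have -> : recip8 (3 * k + 2) = 4 * (~~ odd (3 * k + 2) && possq (3 * k + 2)./2)%:R.
  rewrite recip8E; have -> : possq (3 * k + 2) = false.
    apply/possqP => -[j _ def_j]; have := divn_eq j 3; have := ltn_pmod j (isT : 0 < 3)%N.
    by case: (j %% 3)%N => [|[|[|]]] // _ def3; nia.
  by rewrite mulr0 addr0 addn2 add0r.
apply/eqP; rewrite eqz_mod_dvd subr0; apply/dvdzP.
by exists ((~~ odd (3 * k + 2) && possq (3 * k + 2)./2)%:R + r); ring.
Qed.

Theorem corollary3p2 (l : nat) (hl : (1 <= l)%N) :
  [/\ pscong 4 (fun n => (overp (2 * l)%N (2 * n)%N)%:Z)
        (psinv (psmul (pscomp (-1) 2 phi) (pscomp (-1) l phi))),
      pscong 8 (fun n => (overp (3 * l)%N (3 * n)%N)%:Z)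
        (psdiv (psexp (pscomp (-1) 3 phi) 3) (pscomp (-1) l phi)),
      pscong 8 (fun n => (overp (2 * l)%N (2 * n + 1)%N)%:Z)
        (psscale 2 (psdiv (pscomp 1 4 psi) (pscomp (-1) l phi))),
      forall n : nat, (overp (3 * l) (3 * n + 1) = 0 %[mod 2])%N
    & forall n : nat, (overp (3 * l) (3 * n + 2) = 0 %[mod 4])%N].
Proof.
have unit_pscomp d : pscomp (-1) d phi 0 \is a GRing.unit.
  by rewrite /pscomp dvdn0 div0n phiE possq0 unitr1.
split.
- apply: eq_pscong (overp_cong hl (ltn0Sn 1) psinv_phi_neg_2k) => n.
    by rewrite addn0.
  by rewrite psinvM //; apply: eq_psmul => // k; rewrite psinv_pscomp_phi.
- apply: eq_pscong (overp_cong hl (ltn0Sn 2) psinv_phi_neg_3k) => n //.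
  by rewrite addn0.
- apply: eq_pscong (overp_cong hl (ltnSn 1) psinv_phi_neg_2kp1) => n //.
  (* The dissection puts the scalar 2 on the numerator, the statement on the whole quotient. *)
  rewrite /psscale /psdiv /psmul mulr_sumr; apply: eq_bigr => i _.
  by rewrite mulrA.
- exact: overp_cong0 hl _ psinv_phi_neg_3kp1.
- exact: overp_cong0 hl _ psinv_phi_neg_3kp2.
Qed.
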